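(* Let $F\subseteq\mathbb{R}^n$, $f\colon\mathbb{R}^n\to\mathbb{R}$, and let $(\mathcal{C},\mathcal{D},g,z,\mathcal{T},\epsilon)$ be an $(F,f)$-valid configuration. Let $A_1,A_2,C_1,C_2\subseteq\mathbb{R}^n$ and let $\mathcal{A}_1,\mathcal{A}_2\subseteq\mathcal{P}(\mathbb{R}^n)$ be sets of constraints such that $$[(\mathcal{A}_1\cup\{A_1\})\rightsquigarrow C_1],\ [(\mathcal{A}_2\cup\{A_2\})\rightsquigarrow C_2]\in\mathcal{C}\cup\mathcal{D}\quad\text{and}\quad A_1\cup A_2\supseteq\bigcap(\mathcal{C}\cup\mathcal{D}).$$ Then $(\mathcal{C},\mathcal{D}\cup\{[(\mathcal{A}_1\cup\mathcal{A}_2)\rightsquigarrow(C_1\cup C_2)]\},g,z,\mathcal{T},\epsilon)$ is also $(F,f)$-valid.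
   Context: Constraints are arbitrary subsets of $\mathbb{R}^n$. For $\mathcal{C}\subseteq\mathcal{P}(\mathbb{R}^n)$ (power set) write $\bigcap\mathcal{C}=\bigcap_{C\in\mathcal{C}}C$, with $\bigcap\emptyset=\mathbb{R}^n$. For $\mathcal{A}\subseteq\mathcal{P}(\mathbb{R}^n)$ and $C\subseteq\mathbb{R}^n$, the implication constraint is the set $[\mathcal{A}\rightsquigarrow C]=(\mathbb{R}^n\setminus\bigcap\mathcal{A})\cup C$. For a list $\tau=(i_1,\dots,i_k)\in\{\pm1,\dots,\pm n\}^k$ write $\tau(x)=(\mathrm{sgn}(i_1)x_{|i_1|},\dots,\mathrm{sgn}(i_k)x_{|i_k|})\in\mathbb{R}^k$ for $x\in\mathbb{R}^n$ and $\tau(C)=\{\tau(x):x\in C\}$ for $C\subseteq\mathbb{R}^n$; the empty list is allowed. For another list $\tau'=(i'_1,\dots,i'_{k'})$, write $\tau\trianglelefteq\tau'$ if $k\le k'$ and $i_j=i'_j$ for all $1\le j\le k$. For a node $v$ of a directed graph, $\delta^+(v)$ is its set of children. Branching tree: a tuple $\mathcal{T}=(V,E,B,\sigma)$ is a $\mathcal{C}$-consistent branching tree if: (T1) $(V,E)$ is an arborescence with $1\le|V|<\infty$ and root $r\in V$. (T2) Each $v\in V$ has a branching constraint $B_v\subseteq\mathbb{R}^n$, and $B_r=\mathbb{R}^n$. (T3) For all $u\in V$ with $\delta^+(u)\ne\emptyset$: $\bigcap\mathcal{C}\subseteq\bigcup_{v\in\delta^+(u)}B_v$. (T4) Each $v\in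 V$ has a list $\sigma_v\in\{\pm1,\dots,\pm n\}^{\ell_v}$, $\ell_v\in\{0,\dots,n\}$, with $|(\sigma_v)_1|,\dots,|(\sigma_v)_{\ell_v}|$ pairwise distinct. (T5) $\sigma_u\trianglelefteq\sigma_v$ for all $u\in V$, $v\in\delta^+(u)$. (T6) For all $v\in V$ and $1\le i\le\ell_v$: $\max\{\sigma_v(x)_i:x\in\bigcap\mathcal{C}\}<\infty$ (i.e. the set is bounded above). (T7) For all $u\in V$ and $v\ne w$ in $\delta^+(u)$: $\sigma_u(B_v)\cap\sigma_u(B_w)=\emptyset$. Relations: for $v\in V$ let $\mathcal{B}_v=\{B_u: u \text{ is a node on the } r\text{-}v\text{-path in } \mathcal{T}\}$. For $x,y\in\bigcap\mathcal{C}$ let $\mathrm{dcn}(x,y)$ be the deepest node $w\in V$ with $x,y\in\bigcap(\mathcal{C}\cup\mathcal{B}_w)$. For $\epsilon>0$ and $a,b\in\mathbb{R}^k$, let $a\succ_\epsilon b$ mean $a\neq b$ and $a_i\ge b_i+\epsilon$ for the smallest index $i$ with $a_i\ne b_i$. For $x,y\in\bigcap\mathcal{C}$ and $v=\mathrm{dcn}(x,y)$: $x\succeq_{\epsilon,\mathcal{T}}y$ iff $\sigma_v(x)=\sigma_v(y)$ or $\sigma_v(x)\succ_\epsilon\sigma_v(y)$; $x\succ_{\epsilon,\mathcal{T}}y$ iff $\sigma_v(x)\succ_\epsilon\sigma_v(y)$. Configuration: let $F\subseteq\mathbb{R}^n$, $f\colon\mathbb{R}^n\to\mathbb{R}$.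 A configuration $(\mathcal{C},\mathcal{D},g,z,\mathcal{T},\epsilon)$ with $\mathcal{C},\mathcal{D}\subseteq\mathcal{P}(\mathbb{R}^n)$, $g\colon\mathbb{R}^n\to\mathbb{R}$, $z\in\mathbb{R}\cup\{\infty\}$, $\mathcal{T}$ a branching tree and $\epsilon$ a real number is $(F,f)$-valid if: (V1) $\mathcal{T}$ is $\mathcal{C}$-consistent and $\epsilon>0$. (V2) If $z<\infty$, there exists $x\in F$ with $f(x)\le z$. (V3) For all real $\hat z<z$, there exists $x\in F$ with $f(x)\le\hat z$ if and only if there exists $x\in\bigcap\mathcal{C}$ with $g(x)\le\hat z$. (V4) For every $x\in\bigcap\mathcal{C}$ with $g(x)<z$ there exists $y\in\bigcap(\mathcal{C}\cup\mathcal{D})$ with $y\succeq_{\epsilon,\mathcal{T}}x$ and $g(y)\le g(x)$. *)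

(* Defs.v *)
From HB Require Import structures.
From mathcomp Require Import all_boot all_order all_algebra.
From mathcomp Require Import all_classical all_reals.

Set Implicit Arguments.
Unset Strict Implicit.
Unset Printing Implicit Defensive.

Import Order.TTheory GRing.Theory Num.Theory.

Local Open Scope classical_set_scope.
Local Open Scope ring_scope.

(* Convention: R^n is 'rV[R]_n, a constraint is a term of set 'rV[R]_n. *)

(* Intersection of a family of constraints; the full space if CC is empty. *)
Definition meet_all (R : realType) (n : nat) (CC : set (set 'rV[R]_n)) :
  set 'rV[R]_n := \bigcap_(C in CC) C.

Definition implication (R : realType) (n : nat)
    (AA : set (set 'rV[R]_n)) (C : set 'rV[R]_n) : set 'rV[R]_n :=
  ~` meet_all AA `|` C.

(* {+1, -1, ..., +n, -n}: (b, i) stands for i + 1 if b = false and for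
   -(i + 1) if b = true (coordinates are numbered from 0). *)
Definition signed_index (n : nat) : Type := (bool * 'I_n)%type.

Definition apply_list (R : realType) (n : nat) (s : seq (signed_index n))
    (x : 'rV[R]_n) : 'rV[R]_(size s) :=
  \row_(j < size s)
    ((-1) ^+ (tnth (in_tuple s) j).1 * x ord0 (tnth (in_tuple s) j).2).

Record branching_tree (R : realType) (n : nat) := BranchingTree {
  bt_node : finType;
  bt_edge : rel bt_node;
  bt_root : bt_node;
  bt_constr : bt_node -> set 'rV[R]_n;
  bt_list : bt_node -> seq (signed_index n) }.

Section Tree.
Variables (R : realType) (n : nat) (T : branching_tree R n).
Implicit Types (CC : set (set 'rV[R]_n)) (u v w : bt_node T) (x y : 'rV[R]_n).

(* p lists the nodes after the root on a directed walk from the root to v. *)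
Definition is_root_path v (p : seq (bt_node T)) : Prop :=
  path (@bt_edge R n T) (bt_root T) p /\ last (bt_root T) p = v.

Definition arborescence : Prop :=
  forall v, exists! p : seq (bt_node T), is_root_path v p.

(* The root-v path without its first node; the default value [::] is never
   used when T is an arborescence. *)
Definition root_path v : seq (bt_node T) :=
  xget [::] [set p | is_root_path v p].

Definition node_depth v : nat := size (root_path v).

Definition path_constr v : set (set 'rV[R]_n) :=
  [set bt_constr u | u in [set u : bt_node T | u \in bt_root T :: root_path v]].

Record consistent CC : Prop := Consistent {
  cons_arborescence : arborescence;
  cons_root : bt_constr (bt_root T) = setT;
  cons_cover : forall u, (exists v, bt_edge u v) ->
    meet_all CC `<=`
      \bigcup_(v in [set v : bt_node T | bt_edge u v]) bt_constr v;
  cons_size : forall v, (size (bt_list v) <= n)%N;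
  cons_uniq : forall v, uniq [seq i.2 | i <- bt_list v];
  cons_prefix : forall u v, bt_edge u v -> prefix (bt_list u) (bt_list v);
  cons_bounded : forall v (i : 'I_(size (bt_list v))),
    has_ubound [set apply_list (bt_list v) x ord0 i | x in meet_all CC];
  cons_disjoint : forall u v w, bt_edge u v -> bt_edge u w -> v <> w ->
    apply_list (bt_list u) @` bt_constr v `&`
      apply_list (bt_list u) @` bt_constr w = set0 }.

(* The deepest node w such that x and y satisfy CC and the constraints on the
   path from the root to w. If CC is satisfied by x and y and T is
   CC-consistent, the root is such a node and the deepest one is unique. *)
Definition dcn CC x y : bt_node T :=
  [arg max_(w > bt_root T |
      `[< meet_all (CC `|` path_constr w) x /\
          meet_all (CC `|` path_constr w) y >]) node_depth w]%N.

Definition lex_gt (eps : R) (k : nat) (a b : 'rV[R]_k) : Prop :=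
  a <> b /\
  exists i : 'I_k,
    [/\ a ord0 i <> b ord0 i,
        forall j : 'I_k, (j < i)%N -> a ord0 j = b ord0 j
      & b ord0 i + eps <= a ord0 i].

(* The order x >= y induced by T; meaningful for x and y satisfying CC. *)
Definition tree_ge CC (eps : R) x y : Prop :=
  let s := bt_list (dcn CC x y) in
  apply_list s x = apply_list s y \/
  lex_gt eps (apply_list s x) (apply_list s y).

End Tree.

(* z ranges over R together with +oo; z <> -oo is required separately. *)
Record valid (R : realType) (n : nat) (F : set 'rV[R]_n) (f : 'rV[R]_n -> R)
    (CC DD : set (set 'rV[R]_n)) (g : 'rV[R]_n -> R) (z : \bar R)
    (T : branching_tree R n) (eps : R) : Prop := Valid {
  valid_consistent : consistent T CC /\ 0 < eps;
  valid_bound : (z < +oo)%E -> exists2 x, F x & ((f x)%:E <= z)%E;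
  valid_equiv : forall zh : R, (zh%:E < z)%E ->
    (exists2 x, F x & f x <= zh) <-> (exists2 x, meet_all CC x & g x <= zh);
  valid_dom : forall x, meet_all CC x -> ((g x)%:E < z)%E ->
    exists y, [/\ meet_all (CC `|` DD) y, tree_ge T CC eps y x & g y <= g x] }.

(* Main.v *)
Require Import Defs.
From mathcomp Require Import all_boot all_order all_algebra.
From mathcomp Require Import all_classical all_reals.

Local Open Scope classical_set_scope.
Local Open Scope ring_scope.

(** The resolvent [(AA1 `|` AA2) ~> (C1 `|` C2)] is a logical consequence of the
constraints already present. A point of [meet_all (CC `|` DD)] lies in [A1] or
in [A2]; if it also satisfies all of [AA1 `|` AA2], then in the first case the
first implication puts it in [C1], in the second case the second one puts it in
[C2]. So the new constraint removes no point of [meet_all (CC `|` DD)]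
([resolvent_sound]). Of the conditions for validity, only the dominance
condition mentions the derived constraints, and the dominating point it provides
for [DD] still serves after such an addition ([valid_add_implied]). *)

Lemma implication_mp (R : realType) (n : nat) (AA : set (set 'rV[R]_n))
    (A C : set 'rV[R]_n) (x : 'rV[R]_n) :
  implication (AA `|` [set A]) C x -> meet_all AA x -> A x -> C x.
Proof.
case=> // nAAx AAx Ax; case: nAAx => B [/AAx //|->] //.
Qed.

Lemma resolvent_sound (R : realType) (n : nat) (KK : set (set 'rV[R]_n))
    (A1 A2 C1 C2 : set 'rV[R]_n) (AA1 AA2 : set (set 'rV[R]_n)) :
  KK (implication (AA1 `|` [set A1]) C1) ->
  KK (implication (AA2 `|` [set A2]) C2) ->
  meet_all KK `<=` A1 `|` A2 ->
  meet_all KK `<=` implication (AA1 `|` AA2) (C1 `|` C2).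
Proof.
move=> impl1 impl2 cover x KKx.
have [AAx|nAAx] := pselect (meet_all (AA1 `|` AA2) x); last by left.
right; case: (cover x KKx) => [A1x|A2x].
- left; apply: implication_mp (KKx _ impl1) _ A1x.
  by move=> B AB; apply: AAx; left.
- right; apply: implication_mp (KKx _ impl2) _ A2x.
  by move=> B AB; apply: AAx; right.
Qed.

(** The order [tree_ge T CC eps] is computed from [CC] and not from [DD], so
enlarging [DD] does not change which points dominate [x]: the point that
dominated [x] before only has to meet [D]. *)
Lemma valid_add_implied (R : realType) (n : nat)
    (F : set 'rV[R]_n) (f : 'rV[R]_n -> R)
    (CC DD : set (set 'rV[R]_n)) (g : 'rV[R]_n -> R) (z : \bar R)
    (T : branching_tree R n) (eps : R) (D : set 'rV[R]_n) :
  valid F f CC DD g z T eps -> meet_all (CC `|` DD) `<=` D ->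
  valid F f CC (DD `|` [set D]) g z T eps.
Proof.
case=> consT bound equiv dom subD; split=> // x CCx gx.
have [y [CDy yx gyx]] := dom x CCx gx.
exists y; split=> // B; rewrite setUA => -[/CDy //|->].
exact: subD.
Qed.

Theorem corollary1 (R : realType) (n : nat)
    (F : set 'rV[R]_n) (f : 'rV[R]_n -> R)
    (CC DD : set (set 'rV[R]_n)) (g : 'rV[R]_n -> R) (z : \bar R)
    (T : branching_tree R n) (eps : R)
    (z_range : z <> -oo%E)
    (config_valid : valid F f CC DD g z T eps)
    (A1 A2 C1 C2 : set 'rV[R]_n) (AA1 AA2 : set (set 'rV[R]_n))
    (impl1 : (CC `|` DD) (implication (AA1 `|` [set A1]) C1))
    (impl2 : (CC `|` DD) (implication (AA2 `|` [set A2]) C2))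
    (cover : meet_all (CC `|` DD) `<=` A1 `|` A2) :
  valid F f CC (DD `|` [set implication (AA1 `|` AA2) (C1 `|` C2)]) g z T eps.
Proof.
apply: valid_add_implied config_valid _.
exact: (resolvent_sound _ _ _ _ _ _ _ _ _ impl1 impl2 cover).
Qed.
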